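(* Let $A,B\in\mathbb{C}^{n\times n}$, let $C=\begin{bmatrix} A&B\\ I_n&0\end{bmatrix}$, and let $Q_k\in\mathbb{C}^{n\times d_k}$ be the matrix obtained by the two-level orthogonal Arnoldi (TOAR) method run in a computer with unit roundoff equal to $\epsilon$, i.e., the computed quantities $Q_k,Q_{k+1},\mathbf{U}_k,\mathbf{U}_{k+1},\underline{H}_k$ satisfy $$R=\begin{bmatrix} A&B\\ I_n&0\end{bmatrix}(I_2\otimes Q_k)\mathbf{U}_k-(I_2\otimes Q_{k+1})\mathbf{U}_{k+1}\underline{H}_k\qquad\text{with}\qquad \|R\|_2=O(\epsilon)\|C\|_2.$$ Assume that $Q_k$ has full column rank, and let $\mathcal{S}_k$ be the subspace spanned by the columns of $Q_k$. Then, to first order in $\epsilon$, there exists a $d_k$-dimensional second-order Krylov subspace $\mathcal{G}_k(A+\Delta A,B+\Delta B;\widetilde r_{-1},\widetilde r_0)$ such that $$\mathrm{dist}\bigl(\mathcal{S}_k,\mathcal{G}_k(A+\Delta A,B+\Delta B;\widetilde r_{-1},\widetilde r_0)\bigr)=O(\epsilon)\max\{1,\|A\|_2,\|B\|_2\},$$ for some vectors $\widetilde r_{-1},\widetilde r_0\in\mathbb{C}^n$ and some matrices $\Delta A,\Delta B\in\mathbb{C}^{n\times n}$ with $$\|\Delta A\|_2=O(\epsilon)\max\{1,\|A\|_2,\|B\|_2\}\quad\text{and}\quad\|\Delta B\|_2=O(\epsilon)\bigl(\max\{1,\|A\|_2,\|B\|_2\}\bigr)^2.$$ In words, the columns of the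 computed matrix $Q_k$ span a subspace close to a second-order Krylov subspace associated with matrices $A+\Delta A$ and $B+\Delta B$.
   Context: For $M,N\in\mathbb{C}^{n\times n}$ and $r_{-1},r_0\in\mathbb{C}^n$, define $r_i=Mr_{i-1}+Nr_{i-2}$ for $i=1,\dots,k-1$; the second-order Krylov subspace associated with $M$ and $N$ is $\mathcal{G}_k(M,N;r_{-1},r_0):=\mathrm{span}\{r_{-1},r_0,\dots,r_{k-1}\}$. For subspaces of equal dimension, $\mathrm{dist}(\mathcal{S},\mathcal{T}):=\|P_{\mathcal{S}}-P_{\mathcal{T}}\|_2$ with $P_{\mathcal{S}},P_{\mathcal{T}}$ the orthogonal projectors onto $\mathcal{S},\mathcal{T}$. $\|\cdot\|_2$ is the spectral norm, $\otimes$ the Kronecker product, $^\dagger$ the Moore-Penrose pseudoinverse, and $O(\epsilon)$ denotes any quantity that is upper bounded by $\epsilon$ times a modest constant. The TOAR method is a memory-efficient variant of the Arnoldi method applied to the companion matrix $C$ with starting vector $\begin{bmatrix} r_0\\ r_{-1}\end{bmatrix}$. In exact arithmetic it computes matrices $Q_k$ and $\mathbf{U}_k$ with orthonormal columns and an upper Hessenberg matrix $\underline{H}_k\in\mathbb{C}^{(k+1)\times k}$ with $C(I_2\otimes Q_k)\mathbf{U}_k=(I_2\otimes Q_{k+1})\mathbf{U}_{k+1}\underline{H}_k$, where the columns of $(I_2\otimes Q_k)\mathbf{U}_k$ form an orthonormal basis of the Krylov subspace of $C$ generated by the starting vector, and the columns of $Q_k$ form an orthonormal basis of $\mathcal{G}_k(A,B;r_{-1},r_0)$.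 In floating point arithmetic (with the orthogonalization steps properly carried out) the computed matrices have the following form: $Q_k\in\mathbb{C}^{n\times d_k}$ with $d_k\le k+1$, $Q_{k+1}=\begin{bmatrix} Q_k&q_{k+1}\end{bmatrix}\in\mathbb{C}^{n\times(d_k+1)}$, $\mathbf{U}_k=\begin{bmatrix} U_k^{[1]}\\ U_k^{[2]}\end{bmatrix}\in\mathbb{C}^{2d_k\times k}$, and $\mathbf{U}_{k+1}=\begin{bmatrix} U_{k+1}^{[1]}\\ U_{k+1}^{[2]}\end{bmatrix}\in\mathbb{C}^{2(d_k+1)\times(k+1)}$ with $U_{k+1}^{[1]}=\begin{bmatrix} U_k^{[1]}&x_k\\0&\beta_k\end{bmatrix}$ and $U_{k+1}^{[2]}=\begin{bmatrix} U_k^{[2]}&y_k\\0&0\end{bmatrix}$, for some $x_k,y_k\in\mathbb{C}^{d_k}$, $\beta_k\in\mathbb{C}$. The computed $Q_k,Q_{k+1},\mathbf{U}_k,\mathbf{U}_{k+1}$ have, up to working precision, orthonormal columns; in particular $\|Q_k\|_2\|Q_k^\dagger\|_2=1+O(\epsilon)$ and $\|\mathbf{U}_k\|_2\|\mathbf{U}_k^\dagger\|_2=1+O(\epsilon)$. *)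

(* Defs.v *)
From mathcomp Require Import all_boot all_order all_algebra.
From mathcomp Require Import spectral sesquilinear.
From mathcomp Require Export complex.
From mathcomp Require Import boolp classical_sets reals.

Set Implicit Arguments.
Unset Strict Implicit.
Unset Printing Implicit Defensive.

Import Order.TTheory GRing.Theory Num.Theory.
Local Open Scope ring_scope.
Local Open Scope classical_set_scope.
Local Open Scope sesquilinear_scope.

Definition vnorm2 (R : realType) (n : nat) (x : 'cV[R[i]]_n) : R :=
  Num.sqrt (\sum_(i < n) Normc.normc (x i 0) ^+ 2).

Definition specnorm (R : realType) (m n : nat) (A : 'M[R[i]]_(m, n)) : R :=
  sup [set vnorm2 (A *m x) | x in [set x : 'cV[R[i]]_n | vnorm2 x <= 1]].

Definition colspan (R : realType) (n d : nat) (Q : 'M[R[i]]_(n, d)) :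
    {vspace 'cV[R[i]]_n} :=
  <<[seq col j Q | j : 'I_d]>>%VS.

(* proj_ortho works on row spaces and acts on row vectors from the right, hence
   the two transpositions: x |-> orthproj S *m x projects columns onto S. *)
Definition orthproj (R : realType) (n : nat) (S : {vspace 'cV[R[i]]_n}) :
    'M[R[i]]_n :=
  (proj_ortho (\matrix_(j < \dim S) ((vbasis S)`_j)^T))^T.

Definition dist (R : realType) (n : nat) (S T : {vspace 'cV[R[i]]_n}) : R :=
  specnorm (orthproj S - orthproj T).

(* Indices are shifted by one: soseq M N rm1 r0 j is r_(j-1). *)
Fixpoint soseq (R : realType) (n : nat) (M N : 'M[R[i]]_n)
    (rm1 r0 : 'cV[R[i]]_n) (j : nat) {struct j} : 'cV[R[i]]_n :=
  match j with
  | 0 => rm1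
  | 1 => r0
  | (j''.+1 as j').+1 =>
      M *m soseq M N rm1 r0 j' + N *m soseq M N rm1 r0 j''
  end.

(* span {r_(-1), r_0, ..., r_(k-1)}, which has k + 1 generators *)
Definition sokrylov (R : realType) (n k : nat) (M N : 'M[R[i]]_n)
    (rm1 r0 : 'cV[R[i]]_n) : {vspace 'cV[R[i]]_n} :=
  <<mkseq (soseq M N rm1 r0) k.+1>>%VS.

Definition companion (R : realType) (n : nat) (A B : 'M[R[i]]_n) :
    'M[R[i]]_(n + n) :=
  block_mx A B 1%:M 0.

(* The Kronecker product of I_2 and Q, written as a block matrix so that its
   dimensions match those of the companion matrix. *)
Definition kronI2 (R : realType) (n d : nat) (Q : 'M[R[i]]_(n, d)) :
    'M[R[i]]_(n + n, d + d) :=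
  block_mx Q 0 0 Q.

Definition near_orthonormal (R : realType) (delta : R) (m n : nat)
    (Q : 'M[R[i]]_(m, n)) : Prop :=
  specnorm (Q^t* *m Q - 1%:M) <= delta.

(* Output of k steps of TOAR in precision eps; every "O(eps)" among the
   hypotheses is bounded by c * eps. *)
Record toar_computed (R : realType) (c eps : R) (n k d : nat)
    (A B : 'M[R[i]]_n)
    (Qk : 'M[R[i]]_(n, d)) (Qk1 : 'M[R[i]]_(n, d + 1))
    (Uk : 'M[R[i]]_(d + d, k)) (Uk1 : 'M[R[i]]_((d + 1) + (d + 1), k + 1))
    (Hk : 'M[R[i]]_(k + 1, k)) : Prop := ToarComputed {
  toar_dim : (d <= k.+1)%N;
  toar_Q : exists q : 'cV[R[i]]_n, Qk1 = row_mx Qk q;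
  toar_U : exists (U1 U2 : 'M[R[i]]_(d, k)) (x y : 'cV[R[i]]_d) (beta : R[i]),
      Uk = col_mx U1 U2 /\
      Uk1 = col_mx (block_mx U1 x 0 beta%:M) (block_mx U2 y 0 0);
  toar_hessenberg : forall (i : 'I_(k + 1)) (j : 'I_k),
      (j.+1 < i)%N -> Hk i j = 0;
  toar_orthQk : near_orthonormal (c * eps) Qk;
  toar_orthQk1 : near_orthonormal (c * eps) Qk1;
  toar_orthUk : near_orthonormal (c * eps) Uk;
  toar_orthUk1 : near_orthonormal (c * eps) Uk1;
  toar_residual :
      specnorm (companion A B *m kronI2 Qk *m Uk - kronI2 Qk1 *m Uk1 *m Hk)
        <= c * eps * specnorm (companion A B)
}.

Definition max1norm (R : realType) (n : nat) (A B : 'M[R[i]]_n) : R :=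
  Num.max 1 (Num.max (specnorm A) (specnorm B)).

(* Main.v *)
(* The residual forces no perturbation of the subspace at all: the span of Q_k is
   itself a second-order Krylov subspace of a nearby pair, so the distance is 0.

   The second block row of the residual is Q E with E = U1 - [U2 y] H, hence it
   can be removed without leaving the span of Q. With L a left inverse of
   (U1; U2), put (D1 D2) = - E L, T = (I + D1)^-1 and Y = T D2. Replacing U1 by
   U1 + Y U2 and (U2 y) by T (U2 y) makes the second block row hold exactly. The
   first block row then has residual F + G U2 with F = O(eps) mu and G = O(eps) mu^2;
   since U2 only enters through B, the term G is absorbed by Delta B alone, which
   explains the two different orders in mu.

   It remains to see that the exact companion relation spans the whole of Q. This
   holds when H has no zero subdiagonal entry and (U2 y) has full row rank, and
   both can be achieved by an arbitrarily small perturbation of the data. *)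
Require Import Defs.
From mathcomp Require Import all_boot all_order all_algebra.
From mathcomp Require Import sesquilinear ring lra.
From mathcomp Require Import classical_sets reals.

Set Implicit Arguments.
Unset Strict Implicit.
Unset Printing Implicit Defensive.

Import Order.TTheory GRing.Theory Num.Theory.
Local Open Scope ring_scope.
Local Open Scope sesquilinear_scope.

(** * Euclidean norm of complex columns and the Cauchy-Schwarz inequality *)

Section EuclideanNorm.
Variable R : realType.
Local Notation C := R[i].
Local Notation normc := Normc.normc.

(** Lagrange's identity: the nonnegative double sum of the squares of [a i * b j - a j * b i] is
    twice the difference of the two sides. *)
Lemma cauchy_schwarz_sum (n : nat) (a b : 'I_n -> R) :
  (\sum_i a i * b i) ^+ 2 <= (\sum_i a i ^+ 2) * (\sum_i b i ^+ 2).
Proof.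
have : 0 <= \sum_i \sum_j (a i * b j - a j * b i) ^+ 2.
  by do 2!apply: sumr_ge0 => ? _; exact: sqr_ge0.
set S := \sum_i a i * b i; set A := \sum_i a i ^+ 2; set B := \sum_i b i ^+ 2.
suff -> : \sum_i \sum_j (a i * b j - a j * b i) ^+ 2 = A * B *+ 2 - S ^+ 2 *+ 2.
  by rewrite -mulrnBl pmulrn_lge0 // subr_ge0.
have eAB : A * B = \sum_i \sum_j a i ^+ 2 * b j ^+ 2.
  by rewrite big_distrlr.
have eBA : A * B = \sum_i \sum_j a j ^+ 2 * b i ^+ 2.
  by rewrite exchange_big.
have eS : S ^+ 2 = \sum_i \sum_j (a i * b i) * (a j * b j).
  by rewrite expr2 big_distrlr.
rewrite mulr2n {1}eAB eBA eS -sumrMnl -!big_split -sumrB /=.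
apply: eq_bigr => i _; rewrite -sumrMnl -!big_split -sumrB /=.
by apply: eq_bigr => j _; ring.
Qed.

Lemma normc_ge0 (z : C) : 0 <= normc z.
Proof. by case: z => a b; exact: sqrtr_ge0. Qed.

Lemma normr_normc (z : C) : `|z| = real_complex R (normc z).
Proof. by []. Qed.

Lemma vnorm2_ge0 n (x : 'cV[C]_n) : 0 <= vnorm2 x.
Proof. exact: sqrtr_ge0. Qed.

Lemma sqr_vnorm2 n (x : 'cV[C]_n) :
  vnorm2 x ^+ 2 = \sum_i normc (x i 0) ^+ 2.
Proof. by rewrite sqr_sqrtr // sumr_ge0 // => i _; exact: sqr_ge0. Qed.

Lemma vnorm2_le n (x : 'cV[C]_n) (a : R) :
  0 <= a -> \sum_i normc (x i 0) ^+ 2 <= a ^+ 2 -> vnorm2 x <= a.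
Proof.
by move=> a0 h; rewrite -(ler_pXn2r (n := 2)) ?nnegrE ?vnorm2_ge0 // sqr_vnorm2.
Qed.

Lemma vnorm2_0 n : vnorm2 (0 : 'cV[C]_n) = 0.
Proof.
apply/eqP; rewrite -(sqrf_eq0 (vnorm2 _)) sqr_vnorm2 big1 // => i _.
by rewrite mxE Normc.normc0 expr0n.
Qed.

Lemma vnorm2_eq0 n (x : 'cV[C]_n) : vnorm2 x = 0 -> x = 0.
Proof.
move=> /(congr1 (fun y => y ^+ 2)); rewrite expr0n sqr_vnorm2 /= => /eqP.
rewrite psumr_eq0 => [/allP h|i _]; last exact: sqr_ge0.
apply/matrixP => i j; rewrite ord1 mxE.
have := h i (mem_index_enum i); rewrite /= sqrf_eq0 => /eqP.
exact: Normc.eq0_normc.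
Qed.

Lemma vnorm2Z n (a : C) (x : 'cV[C]_n) : vnorm2 (a *: x) = normc a * vnorm2 x.
Proof.
apply/eqP.
rewrite -(eqrXn2 (n := 2)) ?mulr_ge0 ?normc_ge0 ?vnorm2_ge0 //.
rewrite exprMn !sqr_vnorm2 big_distrr /=.
by apply/eqP/eq_bigr => i _; rewrite mxE Normc.normcM exprMn.
Qed.

Lemma vnorm2N n (x : 'cV[C]_n) : vnorm2 (- x) = vnorm2 x.
Proof.
rewrite -scaleN1r vnorm2Z.
suff -> : normc (-1 : C) = 1 by rewrite mul1r.
by rewrite normcN Normc.normc1.
Qed.

Lemma sum_normcM_le n (x y : 'cV[C]_n) :
  \sum_i normc (x i 0) * normc (y i 0) <= vnorm2 x * vnorm2 y.
Proof.
rewrite -(ler_pXn2r (n := 2)) ?nnegrE ?mulr_ge0 ?vnorm2_ge0 //; last first.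
  by apply: sumr_ge0 => i _; rewrite mulr_ge0 ?normc_ge0.
by rewrite exprMn !sqr_vnorm2; exact: cauchy_schwarz_sum.
Qed.

Lemma vnorm2D n (x y : 'cV[C]_n) : vnorm2 (x + y) <= vnorm2 x + vnorm2 y.
Proof.
apply: vnorm2_le; first by rewrite addr_ge0 ?vnorm2_ge0.
apply: (@le_trans _ _ (\sum_i (normc (x i 0) + normc (y i 0)) ^+ 2)).
  apply: ler_sum => i _; rewrite mxE ler_pXn2r ?nnegrE ?addr_ge0 ?normc_ge0 //.
  exact: le_normcD.
rewrite sqrrD !sqr_vnorm2.
under eq_bigr do rewrite sqrrD.
rewrite !big_split /= lerD2r lerD2l -[leRHS]mulr2n mulr2n.
by apply: lerD; exact: sum_normcM_le.
Qed.

Lemma normc_tr_mulmx n (x y : 'cV[C]_n) :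
  normc ((x^t* *m y) 0 0) <= vnorm2 x * vnorm2 y.
Proof.
apply: le_trans (sum_normcM_le x y).
rewrite -lecR -normr_normc mxE raddf_sum /=.
apply: le_trans (ler_norm_sum _ _ _) _.
by apply: ler_sum => i _; rewrite !mxE normrM norm_conjC !normr_normc -rmorphM.
Qed.

Lemma tr_mulmx_vnorm2 n (x : 'cV[C]_n) :
  (x^t* *m x) 0 0 = real_complex R (vnorm2 x ^+ 2).
Proof.
rewrite sqr_vnorm2 mxE raddf_sum /=; apply: eq_bigr => i _.
by rewrite !mxE rmorphXn /= -normr_normc normCK mulrC.
Qed.

End EuclideanNorm.

(** * Spectral norm: submultiplicativity, adjoints, blocks, and inverses near the identity *)

Section SpectralNorm.
Variable R : realType.
Local Notation C := R[i].
Local Notation normc := Normc.normc.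

Lemma normc_le_vnorm2 n (x : 'cV[C]_n) i : normc (x i 0) <= vnorm2 x.
Proof.
rewrite -(ler_pXn2r (n := 2)) ?nnegrE ?vnorm2_ge0 ?normc_ge0 // sqr_vnorm2.
by rewrite (bigD1 i) //= lerDl sumr_ge0 // => j _; exact: sqr_ge0.
Qed.

Lemma vnorm2_mulmx_bounded m n (A : 'M[C]_(m, n)) :
  exists K, forall x, vnorm2 (A *m x) <= K * vnorm2 x.
Proof.
exists (\sum_j vnorm2 (col j A)) => x.
have -> : A *m x = \sum_j x j 0 *: col j A.
  apply/matrixP => i k; rewrite ord1 !mxE summxE.
  by apply: eq_bigr => j _; rewrite !mxE mulrC.
rewrite big_distrl /=; elim/big_ind2: _ => [|u a v b hu hv|j _].
- by rewrite vnorm2_0.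
- by apply: le_trans (vnorm2D _ _) _; exact: lerD.
- by rewrite vnorm2Z mulrC ler_wpM2l ?vnorm2_ge0 // normc_le_vnorm2.
Qed.

(** This makes the [sup] in [specnorm] a genuine least upper bound rather than a default value. *)
Lemma has_sup_specnorm m n (A : 'M[C]_(m, n)) :
  has_sup [set vnorm2 (A *m x) | x in [set x : 'cV[C]_n | vnorm2 x <= 1]]%classic.
Proof.
split; first by exists (vnorm2 (A *m 0)), 0; rewrite //= vnorm2_0 ler01.
have [K hK] := vnorm2_mulmx_bounded A.
exists (Num.max K 0) => _ [x /= x1 <-].
apply: le_trans (hK x) _; apply: (@le_trans _ _ (Num.max K 0 * vnorm2 x)).
  by rewrite ler_wpM2r ?vnorm2_ge0 // le_max lexx.
by rewrite ler_piMr // le_max lexx orbT.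
Qed.

Lemma vnorm2_mulmx m n (A : 'M[C]_(m, n)) x :
  vnorm2 (A *m x) <= specnorm A * vnorm2 x.
Proof.
have [x0|x0] := eqVneq (vnorm2 x) 0.
  by rewrite (vnorm2_eq0 x0) mulmx0 !vnorm2_0 mulr0.
have xgt0 : 0 < vnorm2 x by rewrite lt_def x0 vnorm2_ge0.
rewrite -ler_pdivrMr //.
apply: sup_upper_bound; first exact: has_sup_specnorm.
have nV : normc (real_complex R (vnorm2 x)^-1) = (vnorm2 x)^-1.
  by rewrite /= expr0n addr0 sqrtr_sqr ger0_norm // invr_ge0 vnorm2_ge0.
exists (real_complex R (vnorm2 x)^-1 *: x).
  by rewrite /= vnorm2Z nV mulVf.
by rewrite -scalemxAr vnorm2Z nV mulrC.
Qed.

Lemma specnorm_le m n (A : 'M[C]_(m, n)) a :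
  0 <= a -> (forall x, vnorm2 (A *m x) <= a * vnorm2 x) -> specnorm A <= a.
Proof.
move=> a0 h; apply: ge_sup; first exact: (has_sup_specnorm A).1.
move=> _ [x /= x1 <-]; apply: le_trans (h x) _.
by rewrite ler_piMr.
Qed.

Lemma specnorm_ge0 m n (A : 'M[C]_(m, n)) : 0 <= specnorm A.
Proof.
apply: sup_upper_bound; first exact: has_sup_specnorm.
by exists 0; rewrite /= ?mulmx0 vnorm2_0 ?ler01.
Qed.

Lemma specnorm0 m n : specnorm (0 : 'M[C]_(m, n)) = 0.
Proof.
apply/le_anti; rewrite specnorm_ge0 andbT; apply: specnorm_le => // x.
by rewrite mul0mx vnorm2_0 mul0r.
Qed.

Lemma specnormD m n (A B : 'M[C]_(m, n)) :
  specnorm (A + B) <= specnorm A + specnorm B.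
Proof.
apply: specnorm_le => [|x]; first by rewrite addr_ge0 ?specnorm_ge0.
rewrite mulmxDl mulrDl; apply: le_trans (vnorm2D _ _) _.
by apply: lerD; exact: vnorm2_mulmx.
Qed.

Lemma specnormN m n (A : 'M[C]_(m, n)) : specnorm (- A) = specnorm A.
Proof.
apply/le_anti/andP; split; apply: specnorm_le => [|x]; rewrite ?specnorm_ge0 //.
  by rewrite mulNmx vnorm2N vnorm2_mulmx.
by rewrite -[A in leLHS]opprK mulNmx vnorm2N vnorm2_mulmx.
Qed.

Lemma specnormM m n p (A : 'M[C]_(m, n)) (B : 'M[C]_(n, p)) :
  specnorm (A *m B) <= specnorm A * specnorm B.
Proof.
apply: specnorm_le => [|x]; first by rewrite mulr_ge0 ?specnorm_ge0.
rewrite -mulmxA -mulrA; apply: le_trans (vnorm2_mulmx _ _) _.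
by rewrite ler_wpM2l ?specnorm_ge0 // vnorm2_mulmx.
Qed.

Lemma specnorm_scale m n (t : R) (A : 'M[C]_(m, n)) :
  0 <= t -> specnorm (real_complex R t *: A) <= t * specnorm A.
Proof.
move=> t0; apply: specnorm_le => [|x]; first by rewrite mulr_ge0 ?specnorm_ge0.
rewrite -scalemxAl vnorm2Z /= expr0n addr0 sqrtr_sqr ger0_norm // -mulrA.
by rewrite ler_wpM2l // vnorm2_mulmx.
Qed.

Lemma specnorm1 n : specnorm (1%:M : 'M[C]_n) <= 1.
Proof. by apply: specnorm_le => // x; rewrite mul1mx mul1r. Qed.

(** With [z = A^t* *m y], the square of the norm of [z] is the inner product of [y] with [A *m z].
    Cauchy-Schwarz bounds it, and one factor [vnorm2 z] cancels. *)
Lemma specnorm_trmxC m n (A : 'M[C]_(m, n)) : specnorm (A^t*) <= specnorm A.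
Proof.
apply: specnorm_le => [|y]; rewrite ?specnorm_ge0 //.
have [z0|z0] := eqVneq (vnorm2 (A^t* *m y)) 0.
  by rewrite z0 mulr_ge0 ?specnorm_ge0 ?vnorm2_ge0.
have zgt0 : 0 < vnorm2 (A^t* *m y) by rewrite lt_def z0 vnorm2_ge0.
rewrite -(ler_pM2l zgt0) -expr2.
have -> : vnorm2 (A^t* *m y) ^+ 2 = normc ((y^t* *m (A *m (A^t* *m y))) 0 0).
  rewrite mulmxA -[A in y^t* *m A]trmxCK -map_mxM -trmx_mul tr_mulmx_vnorm2 /=.
  by rewrite expr0n addr0 sqrtr_sqr ger0_norm ?sqr_ge0.
apply: le_trans (normc_tr_mulmx _ _) _.
rewrite mulrC mulrCA [leRHS]mulrA ler_wpM2r ?vnorm2_ge0 //.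
by rewrite vnorm2_mulmx.
Qed.

Lemma vnorm2_col_mx m n (x : 'cV[C]_m) (y : 'cV[C]_n) :
  vnorm2 (col_mx x y) ^+ 2 = vnorm2 x ^+ 2 + vnorm2 y ^+ 2.
Proof.
rewrite !sqr_vnorm2 big_split_ord /=.
by congr (_ + _); apply: eq_bigr => i _; rewrite ?col_mxEu ?col_mxEd.
Qed.

Lemma vnorm2_usubmx m n (x : 'cV[C]_(m + n)) : vnorm2 (usubmx x) <= vnorm2 x.
Proof.
rewrite -(ler_pXn2r (n := 2)) ?nnegrE ?vnorm2_ge0 // -[x in leRHS]vsubmxK.
by rewrite vnorm2_col_mx lerDl sqr_ge0.
Qed.

Lemma vnorm2_dsubmx m n (x : 'cV[C]_(m + n)) : vnorm2 (dsubmx x) <= vnorm2 x.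
Proof.
rewrite -(ler_pXn2r (n := 2)) ?nnegrE ?vnorm2_ge0 // -[x in leRHS]vsubmxK.
by rewrite vnorm2_col_mx lerDr sqr_ge0.
Qed.

Lemma vnorm2_col_mx_le m n (x : 'cV[C]_m) (y : 'cV[C]_n) :
  vnorm2 (col_mx x y) <= vnorm2 x + vnorm2 y.
Proof.
rewrite -(ler_pXn2r (n := 2)) ?nnegrE ?addr_ge0 ?vnorm2_ge0 // vnorm2_col_mx.
by rewrite sqrrD lerD2r lerDl mulrn_wge0 // mulr_ge0 ?vnorm2_ge0.
Qed.

Lemma specnorm_usubmx m n p (A : 'M[C]_(m + n, p)) :
  specnorm (usubmx A) <= specnorm A.
Proof.
apply: specnorm_le => [|x]; rewrite ?specnorm_ge0 //.
by rewrite mul_usub_mx; apply: le_trans (vnorm2_usubmx _) (vnorm2_mulmx _ _).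
Qed.

Lemma specnorm_dsubmx m n p (A : 'M[C]_(m + n, p)) :
  specnorm (dsubmx A) <= specnorm A.
Proof.
apply: specnorm_le => [|x]; rewrite ?specnorm_ge0 //.
by rewrite mul_dsub_mx; apply: le_trans (vnorm2_dsubmx _) (vnorm2_mulmx _ _).
Qed.

Lemma specnorm_lsubmx m n p (A : 'M[C]_(m, n + p)) :
  specnorm (lsubmx A) <= specnorm A.
Proof.
apply: specnorm_le => [|x]; rewrite ?specnorm_ge0 //.
have -> : lsubmx A *m x = A *m col_mx x 0.
  by rewrite -[A in RHS]hsubmxK mul_row_col mulmx0 addr0.
apply: le_trans (vnorm2_mulmx _ _) _; rewrite ler_wpM2l ?specnorm_ge0 //.
by apply: le_trans (vnorm2_col_mx_le _ _) _; rewrite vnorm2_0 addr0.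
Qed.

Lemma specnorm_rsubmx m n p (A : 'M[C]_(m, n + p)) :
  specnorm (rsubmx A) <= specnorm A.
Proof.
apply: specnorm_le => [|x]; rewrite ?specnorm_ge0 //.
have -> : rsubmx A *m x = A *m col_mx 0 x.
  by rewrite -[A in RHS]hsubmxK mul_row_col mulmx0 add0r.
apply: le_trans (vnorm2_mulmx _ _) _; rewrite ler_wpM2l ?specnorm_ge0 //.
by apply: le_trans (vnorm2_col_mx_le _ _) _; rewrite vnorm2_0 add0r.
Qed.

Lemma specnorm_companion n (A B : 'M[C]_n) :
  specnorm (companion A B) <= specnorm A + specnorm B + 1.
Proof.
apply: specnorm_le => [|x]; first by rewrite !addr_ge0 ?specnorm_ge0.
rewrite -[x in leLHS]vsubmxK mul_block_col mul1mx mul0mx addr0.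
apply: le_trans (vnorm2_col_mx_le _ _) _; rewrite !mulrDl mul1r lerD //.
  apply: le_trans (vnorm2D _ _) _; apply: lerD.
    apply: le_trans (vnorm2_mulmx _ _) _.
    by rewrite ler_wpM2l ?specnorm_ge0 // vnorm2_usubmx.
  apply: le_trans (vnorm2_mulmx _ _) _.
  by rewrite ler_wpM2l ?specnorm_ge0 // vnorm2_dsubmx.
exact: vnorm2_usubmx.
Qed.

(** The lower bound [vnorm2 x <= 2 * vnorm2 ((1%:M + D) *m x)] yields both claims: it makes the
    kernel trivial, and applied to the image under the inverse it bounds the inverse. *)
Lemma unitmx_near1 n (D : 'M[C]_n) : specnorm D <= 2^-1 ->
  (1%:M + D) \in unitmx /\ specnorm (invmx (1%:M + D)) <= 2.
Proof.
move=> hD.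
have lb x : vnorm2 x <= 2 * vnorm2 ((1%:M + D) *m x).
  have h1 : vnorm2 x <= vnorm2 ((1%:M + D) *m x) + vnorm2 (D *m x).
    rewrite -(vnorm2N (D *m x)); apply: le_trans (vnorm2D _ _).
    by rewrite mulmxDl mul1mx addrK.
  have h2 : vnorm2 (D *m x) <= 2^-1 * vnorm2 x.
    by apply: le_trans (vnorm2_mulmx _ _) _; rewrite ler_wpM2r ?vnorm2_ge0.
  lra.
have u : (1%:M + D) \in unitmx.
  rewrite -unitmx_tr -row_free_unit -kermx_eq0; apply/eqP/row_matrixP => i.
  rewrite row0; apply: trmx_inj; rewrite trmx0; apply: vnorm2_eq0.
  apply/le_anti; rewrite vnorm2_ge0 andbT; apply: le_trans (lb _) _.
  have -> : (1%:M + D) *m (row i (kermx (1%:M + D)^T))^T = 0.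
    rewrite -[X in X *m _]trmxK -trmx_mul -row_mul mulmx_ker.
    by rewrite row0 trmx0.
  by rewrite vnorm2_0 mulr0.
split=> //; apply: specnorm_le => [|x]; first by lra.
by apply: le_trans (lb _) _; rewrite mulKVmx.
Qed.

(** The Gram matrix [Q^t* *m Q] is within 1/2 of the identity, hence invertible with inverse of norm
    at most 2. The witness [L] is the Moore-Penrose pseudoinverse of [Q], and 4 is 2 for the inverse
    Gram matrix times 2 for the adjoint. *)
Lemma near_orthonormal_inverse m n (Q : 'M[C]_(m, n)) :
  near_orthonormal 2^-1 Q ->
  specnorm Q <= 2 /\ exists L, L *m Q = 1%:M /\ specnorm L <= 4.
Proof.
move=> hQ; have Q2 : specnorm Q <= 2.
  apply: specnorm_le => [|x]; first by lra.
  have hx : vnorm2 (Q^t* *m Q *m x) <= 2 * vnorm2 x.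
    have -> : Q^t* *m Q *m x = (Q^t* *m Q - 1%:M) *m x + x.
      by rewrite mulmxBl mul1mx subrK.
    apply: le_trans (vnorm2D _ _) _.
    have := vnorm2_mulmx (Q^t* *m Q - 1%:M) x.
    have := ler_wpM2r (vnorm2_ge0 x) hQ.
    have := vnorm2_ge0 x.
    lra.
  rewrite -(ler_pXn2r (n := 2)) ?nnegrE ?mulr_ge0 ?vnorm2_ge0 //.
  have -> : vnorm2 (Q *m x) ^+ 2 = normc ((x^t* *m (Q^t* *m Q *m x)) 0 0).
    rewrite -mulmxA mulmxA -map_mxM -trmx_mul tr_mulmx_vnorm2 /=.
    by rewrite expr0n addr0 sqrtr_sqr ger0_norm ?sqr_ge0.
  apply: le_trans (normc_tr_mulmx _ _) _.
  have := vnorm2_ge0 x; nra.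
split=> //.
have [u hu] := unitmx_near1 hQ; rewrite addrC subrK in u hu.
exists (invmx (Q^t* *m Q) *m Q^t*); split; first by rewrite -mulmxA mulVmx.
apply: le_trans (specnormM _ _) _.
have := specnorm_trmxC Q; have := specnorm_ge0 (Q^t*).
have := specnorm_ge0 (invmx (Q^t* *m Q)); nra.
Qed.

End SpectralNorm.

(** * Column spans, and second-order Krylov subspaces read off an exact companion relation *)

Section KrylovSpan.
Variable R : realType.
Local Notation C := R[i].

Lemma mem_colspan n d (Q : 'M[C]_(n, d)) (x : 'cV_d) : Q *m x \in colspan Q.
Proof.
have -> : Q *m x = \sum_j x j 0 *: col j Q.
  apply/matrixP => i k; rewrite ord1 !mxE summxE.
  by apply: eq_bigr => j _; rewrite !mxE mulrC.
by apply: memv_suml => j _; apply/memvZ/memv_span/map_f; rewrite mem_enum.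
Qed.

Lemma colspan_mulmx_sub n d p (Q : 'M[C]_(n, d)) (M : 'M_(d, p)) :
  (colspan (Q *m M) <= colspan Q)%VS.
Proof.
apply/span_subvP => _ /mapP[j _ ->].
by rewrite colE -mulmxA mem_colspan.
Qed.

Lemma colspan_mulmx n d p (Q : 'M[C]_(n, d)) (M : 'M_(d, p)) :
  row_free M -> colspan (Q *m M) = colspan Q.
Proof.
move=> /row_freeP[N MN]; apply/eqP; rewrite eqEsubv colspan_mulmx_sub /=.
by rewrite -[Q in (colspan Q <= _)%VS]mulmx1 -MN mulmxA colspan_mulmx_sub.
Qed.

Lemma dim_colspan n d (Q : 'M[C]_(n, d)) (L : 'M_(d, n)) :
  L *m Q = 1%:M -> \dim (colspan Q) = d.
Proof.
move=> LQ; have szd : size [seq col j Q | j : 'I_d] = d.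
  by rewrite size_map -cardE card_ord.
suff : free [seq col j Q | j : 'I_d] by rewrite /free szd => /eqP.
apply/(@freeP _ _ _ (in_tuple _)) => x /= Qx i0.
have /(congr1 (fun M => L *m M)) :
    Q *m (\col_j x (cast_ord (esym szd) j)) = 0.
  rewrite -[RHS]Qx; apply/matrixP => i k; rewrite ord1 !mxE summxE.
  rewrite (reindex (cast_ord szd)) /=; last first.
    by exists (cast_ord (esym szd)) => y _; rewrite ?cast_ordK ?cast_ordKV.
  apply: eq_bigr => j _; rewrite !mxE cast_ordK mulrC; congr (_ * _).
  rewrite (nth_map (cast_ord szd j)) -?cardE ?card_ord ?ltn_ord //.
    by have /= -> := nth_ord_enum (cast_ord szd j) (cast_ord szd j); rewrite mxE.
  by rewrite -[X in (_ < X)%N]szd ltn_ord.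
rewrite mulmxA LQ mul1mx mulmx0 => /matrixP /(_ (cast_ord szd i0) 0).
by rewrite !mxE cast_ordK.
Qed.

(* p starts as the first unit vector and is multiplied by H at each step, so the
   nonzero subdiagonal of H pushes its last nonzero entry down to row j. *)
Lemma soseq_coordinates n k (A B : 'M[C]_n) (P S : 'M[C]_(n, k + 1))
    (H : 'M[C]_(k + 1, k)) :
  (forall (i : 'I_(k + 1)) (j : 'I_k), (j.+1 < i)%N -> H i j = 0) ->
  (forall (i : 'I_(k + 1)) (j : 'I_k), i = j.+1 :> nat -> H i j != 0) ->
  A *m lsubmx P + B *m lsubmx S = P *m H -> lsubmx P = S *m H ->
  forall i0 : 'I_(k + 1), i0 = 0%N :> nat -> forall j : 'I_(k + 1),
  exists p : 'cV[C]_(k + 1),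
    [/\ P *m p = soseq A B (col i0 S) (col i0 P) j.+1,
        S *m p = soseq A B (col i0 S) (col i0 P) j,
        forall i : 'I_(k + 1), (j < i)%N -> p i 0 = 0 & p j 0 != 0].
Proof.
move=> Hhess Hsub eqP1 eqS i0 i00 [j jk]; elim: j jk => [|j IH] jk.
  have <- : i0 = Ordinal jk by exact: val_inj.
  exists (delta_mx i0 0); rewrite -!colE i00; split=> //.
    by move=> i /= ii; rewrite mxE -val_eqE /= i00 eqn0Ngt ii.
  by rewrite mxE !eqxx oner_eq0.
have jk1 : (j < k + 1)%N by exact: ltnW.
have [p [Pp Sp p0 pj]] := IH jk1.
have jltk : (j < k)%N by rewrite addn1 in jk.
(* Since [j < k], the last entry of [p], at index [k], is zero. Hence [usubmx p], which has the
   length that [H] accepts, loses nothing. *)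
have dp : dsubmx p = 0.
  apply/matrixP => a b; rewrite !ord1 !mxE p0 //=.
  by rewrite addn0.
have lp (T : 'M[C]_(n, k + 1)) : lsubmx T *m usubmx p = T *m p.
  by rewrite -[p in RHS]vsubmxK -[T in RHS]hsubmxK mul_row_col dp mulmx0 addr0.
have sum_eq (i : 'I_(k + 1)) :
    (H *m usubmx p) i 0 = \sum_(a < k) H i a * p (lshift 1 a) 0.
  by rewrite mxE; apply: eq_bigr => a _; rewrite mxE.
exists (H *m usubmx p); split.
- by rewrite mulmxA -eqP1 mulmxDl -!mulmxA !lp Pp Sp.
- by rewrite mulmxA -eqS lp Pp.
- move=> i /= ji; rewrite sum_eq big1 // => a _.
  have [aj|ja] := leqP a j; last by rewrite p0 ?mulr0.
  by rewrite Hhess ?mul0r // (leq_ltn_trans _ ji).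
- rewrite sum_eq (bigD1 (Ordinal jltk)) //= big1 => [|a aj].
    have -> : lshift 1 (Ordinal jltk) = Ordinal jk1 by exact: val_inj.
    by rewrite addr0 mulf_neq0 // Hsub.
  have [|ja] := ltnP a j; first by move=> aj'; rewrite Hhess ?mul0r.
  by rewrite p0 ?mulr0 //= ltn_neqAle ja andbT eq_sym; exact: aj.
Qed.

(** The two equations are the block rows of the companion relation for [P] stacked on [S]. The
    coordinate vectors of the Krylov sequence with respect to [S] form an upper triangular matrix
    [T] with nonzero diagonal, so passing from [S] to [S *m T] keeps the span. *)
Lemma sokrylov_colspan n k (A B : 'M[C]_n) (P S : 'M[C]_(n, k + 1))
    (H : 'M[C]_(k + 1, k)) :
  (forall (i : 'I_(k + 1)) (j : 'I_k), (j.+1 < i)%N -> H i j = 0) ->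
  (forall (i : 'I_(k + 1)) (j : 'I_k), i = j.+1 :> nat -> H i j != 0) ->
  A *m lsubmx P + B *m lsubmx S = P *m H -> lsubmx P = S *m H ->
  exists rm1 r0, sokrylov k A B rm1 r0 = colspan S.
Proof.
move=> Hhess Hsub eqP1 eqS.
have k0 : (0 < k + 1)%N by rewrite addn1.
have [f fP] := fin_all_exists
  (soseq_coordinates Hhess Hsub eqP1 eqS (i0 := Ordinal k0) (erefl _)).
exists (col (Ordinal k0) S), (col (Ordinal k0) P).
pose T := \matrix_(i, j) f j i 0.
have Tfree : row_free T.
  rewrite row_free_unit -unitmx_tr unitmxE det_trig.
    rewrite unitfE prodf_seq_neq0; apply/allP => i _ /=.
    by rewrite !mxE; have [] := fP i.
  apply/is_trig_mxP => i j ij; rewrite !mxE.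
  by have [_ _ fi0 _] := fP i; exact: fi0.
rewrite -(colspan_mulmx S Tfree) /sokrylov /colspan; congr <<_>>%VS.
have -> : k.+1 = (k + 1)%N by rewrite addn1.
rewrite /mkseq -val_enum_ord -map_comp; apply: eq_map => j /=.
have [_ <- _ _] := fP j.
rewrite colE -mulmxA -colE; congr (_ *m _).
by apply/matrixP => a b; rewrite ord1 !mxE.
Qed.

End KrylovSpan.

(** In the rank normal form of [W], the matrix [N] occupies exactly the diagonal places that are
    zero in [W]. The perturbed normal form then has diagonal entries 1 and [t], all nonzero. *)
Lemma row_free_perturbation (F : fieldType) m n (W : 'M[F]_(m, n)) :
  (m <= n)%N -> exists N, forall t, t != 0 -> row_free (W + t *: N).
Proof.
move=> mn; set r := \rank W.
exists (col_ebase W *m (pid_mx m - pid_mx r) *m row_ebase W) => t t0.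
pose D : 'M[F]_m := diag_mx (\row_j if (j < r)%N then 1 else t).
have -> : W + t *: (col_ebase W *m (pid_mx m - pid_mx r) *m row_ebase W) =
    col_ebase W *m (D *m pid_mx m) *m row_ebase W.
  rewrite -[X in X + _](mulmx_ebase W) scalemxAl scalemxAr -mulmxDl -mulmxDr.
  congr (_ *m _ *m _); apply/matrixP => i j.
  rewrite mul_diag_mx !mxE ltn_ord andbT -/r.
  by case: (i == j :> nat); case: (i < r)%N => /=;
    rewrite ?(subrr, mulr0, mulr1, addr0, subr0, add0r).
have Dunit : D \in unitmx.
  rewrite unitmxE det_diag unitfE prodf_seq_neq0; apply/allP => i _ /=.
  by rewrite mxE; case: ifP => _; rewrite ?oner_eq0.
rewrite /row_free mxrankMfree ?row_free_unit ?row_ebase_unit //.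
rewrite !eqmxMfull ?row_full_unit ?col_ebase_unit //.
by rewrite rank_pid_mx.
Qed.

(** * Absorbing the residual into the coefficients, in the nondegenerate case *)

Section BackwardError.
Variable R : realType.
Local Notation C := R[i].

Lemma specnormM_le m n p (A : 'M[C]_(m, n)) (B : 'M[C]_(n, p)) a b :
  specnorm A <= a -> specnorm B <= b -> specnorm (A *m B) <= a * b.
Proof.
by move=> ha hb; apply: le_trans (specnormM A B) _; rewrite ler_pM ?specnorm_ge0.
Qed.

Lemma specnormD_le m n (A B : 'M[C]_(m, n)) a b :
  specnorm A <= a -> specnorm B <= b -> specnorm (A + B) <= a + b.
Proof. by move=> ha hb; apply: le_trans (specnormD A B) _; rewrite lerD. Qed.

Lemma specnormN_le m n (A : 'M[C]_(m, n)) a :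
  specnorm A <= a -> specnorm (- A) <= a.
Proof. by rewrite specnormN. Qed.

(** The case where [H] has no zero subdiagonal entry and [row_mx U2 y] has full row rank. The bounds
    8 and 3 on [L] and [U1] leave room for the perturbation that reduces the general case to this
    one. *)
Lemma backward_error n k d (A B : 'M[C]_n) (Q : 'M_(n, d)) (Qi : 'M_(d, n))
    (U1 U2 : 'M_(d, k)) (y : 'cV_d) (L : 'M_(k, d + d)) (z : 'cV_n)
    (H : 'M_(k + 1, k)) (eta mu : R) :
  Qi *m Q = 1%:M -> specnorm Q <= 2 -> specnorm Qi <= 4 ->
  L *m col_mx U1 U2 = 1%:M -> specnorm L <= 8 -> specnorm U1 <= 3 ->
  1 <= mu -> specnorm A <= mu -> specnorm B <= mu ->
  0 <= eta -> 64 * eta <= 1 ->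
  specnorm (Q *m (U1 - row_mx U2 y *m H)) <= eta ->
  specnorm (A *m Q *m U1 + B *m Q *m U2 - row_mx (Q *m U1) z *m H) <= eta ->
  (forall (i : 'I_(k + 1)) (j : 'I_k), (j.+1 < i)%N -> H i j = 0) ->
  (forall (i : 'I_(k + 1)) (j : 'I_k), i = j.+1 :> nat -> H i j != 0) ->
  row_free (row_mx U2 y) ->
  exists dA dB rm1 r0,
    [/\ sokrylov k (A + dA) (B + dB) rm1 r0 = colspan Q,
        specnorm dA <= 300 ^+ 2 * eta & specnorm dB <= 300 ^+ 2 * eta * mu].
Proof.
move=> QiQ nQ nQi LU nL nU1 mu1 nA nB eta0 eta64 nE nR Hhess Hsub Wfree.
set W := row_mx U2 y in nE Wfree; set P0 := row_mx (Q *m U1) z in nR.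
set E := U1 - W *m H in nE; set R1 := (X in specnorm X <= _) in nR.
(* Applying the left inverse [Qi], of norm at most 4, strips [Q] from the residual. *)
have {}nE : specnorm E <= 4 * eta.
  by rewrite -[E]mul1mx -QiQ -mulmxA; exact: specnormM_le.
pose D := - (E *m L); pose D1 := lsubmx D; pose D2 := rsubmx D.
have nD : specnorm D <= 4 * eta * 8 by exact/specnormN_le/specnormM_le.
have nD1 : specnorm D1 <= 4 * eta * 8 := le_trans (specnorm_lsubmx D) nD.
have nD2 : specnorm D2 <= 4 * eta * 8 := le_trans (specnorm_rsubmx D) nD.
have eqD : D1 *m U1 + D2 *m U2 = - E.
  by rewrite -mul_row_col hsubmxK mulNmx -mulmxA LU mulmx1.
have hD : 4 * eta * 8 <= 2^-1 by clear -eta64; lra.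
have [Dunit nT] := unitmx_near1 (le_trans nD1 hD).
set T := invmx (1%:M + D1) in nT.
have TD : T *m (1%:M + D1) = 1%:M by exact: mulVmx.
have DT : (1%:M + D1) *m T = 1%:M by exact: mulmxV.
pose Y := T *m D2.
have nY : specnorm Y <= 2 * (4 * eta * 8) by exact: specnormM_le.
have nT1 : specnorm (T - 1%:M) <= 2 * (4 * eta * 8).
  have -> : T - 1%:M = - (T *m D1) by rewrite -TD mulmxDr mulmx1 opprD addNKr.
  exact/specnormN_le/specnormM_le.
(* Here [W *m H = U1 - E], and [- E = D1 *m U1 + D2 *m U2], so
   [W *m H = (1%:M + D1) *m U1 + D2 *m U2]; multiplying by [T] leaves [U1 + Y *m U2]. *)
have eqTW : T *m W *m H = U1 + Y *m U2.
  have -> : T *m W *m H = T *m (U1 - E) by rewrite -mulmxA subKr.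
  rewrite -eqD addrA mulmxDr mulmxA -/Y; congr (_ + _).
  by rewrite -[X in X + _]mul1mx -mulmxDl mulmxA TD mul1mx.
clearbody Y.
pose L1 := lsubmx L; pose L2 := rsubmx L.
have nL1 : specnorm L1 <= 8 := le_trans (specnorm_lsubmx L) nL.
have nL2 : specnorm L2 <= 8 := le_trans (specnorm_rsubmx L) nL.
have LU12 : L1 *m U1 + L2 *m U2 = 1%:M by rewrite -mul_row_col hsubmxK.
(* The subtracted term is [Q *m Y *m W *m H], by which the right-hand side grows once [P0] becomes
   [P0 + Q *m Y *m W]. In the bound, 513 = 1 + 2 * 64 * 4, where 4 bounds [3 + 4 * eta]. *)
pose F := R1 - Q *m Y *m (U1 - E).
have nF : specnorm F <= 513 * eta.
  apply: le_trans (specnormD_le nR (specnormN_le (specnormM_le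
    (specnormM_le nQ nY) (specnormD_le nU1 (specnormN_le nE))))) _.
  by clear -eta0 eta64; nra.
have defF : F = R1 - Q *m Y *m (U1 - E) by [].
clearbody F.
(* [G *m U2] is the change of the left-hand side when [U1] becomes [U1 + Y *m U2] and [U2] becomes
   [T *m U2]. The residual to cancel is therefore [F + G *m U2]. *)
pose G := A *m Q *m Y + B *m Q *m (T - 1%:M).
have nG : specnorm G <= mu * 2 * (2 * (4 * eta * 8)) + mu * 2 * (2 * (4 * eta * 8)).
  by apply: specnormD_le; apply: specnormM_le => //; exact: specnormM_le.
(* [Qi] recovers coordinates and [1%:M + D1] undoes [T]. Since [U1] has become [U1 + Y *m U2], [dA]
   creates an extra [F *m L1 *m Y *m U2], which [dB] compensates; what remains is [F] times
   [L1 *m U1 + L2 *m U2 = 1%:M], together with [G *m U2]. *)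
pose dA := - (F *m L1 *m Qi).
pose dB := - ((F *m (L2 - L1 *m Y) + G) *m (1%:M + D1) *m Qi).
pose S := Q *m (T *m W); pose P := P0 + Q *m Y *m W.
have lS : lsubmx S = Q *m (T *m U2).
  by rewrite /S /W !mul_mx_row row_mxKl.
have lP : lsubmx P = Q *m (U1 + Y *m U2).
  by rewrite /P /P0 /W mul_mx_row add_row_mx row_mxKl mulmxDr mulmxA.
have eqS : lsubmx P = S *m H by rewrite lP -eqTW /S !mulmxA.
have eqdA : dA *m lsubmx P = - (F *m (L1 *m U1) + F *m (L1 *m Y *m U2)).
  rewrite lP mulNmx -[_ *m Qi *m _]mulmxA [Qi *m _]mulmxA QiQ mul1mx.
  by rewrite -[F *m L1 *m _]mulmxA -mulmxDr mulmxDr mulmxA.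
have eqdB : dB *m lsubmx S = - (F *m (L2 *m U2) - F *m (L1 *m Y *m U2) + G *m U2).
  rewrite lS mulNmx -[_ *m Qi *m _]mulmxA [Qi *m _]mulmxA QiQ mul1mx.
  rewrite -[_ *m (1%:M + D1) *m _]mulmxA [(1%:M + D1) *m _]mulmxA DT mul1mx.
  by rewrite mulmxDl -[F *m _ *m U2]mulmxA mulmxBl mulmxBr.
have eqPH : (A + dA) *m lsubmx P + (B + dB) *m lsubmx S = P *m H.
  rewrite mulmxDl [(B + dB) *m _]mulmxDl eqdA eqdB.
  have eF : F = F *m (L1 *m U1) + F *m (L2 *m U2) by rewrite -mulmxDr LU12 mulmx1.
  have -> : P *m H = A *m Q *m U1 + B *m Q *m U2 - F.
    rewrite defF /R1 /E subKr /P mulmxDl -[Q *m Y *m W *m H]mulmxA.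
    by rewrite opprB addrCA subKr addrC.
  rewrite [in RHS]eF lP lS /G mulmxDl mulmxBr mulmxBl mulmx1 !mulmxDr !mulmxA.
  move: (A *m Q *m U1) (B *m Q *m U2) (F *m L1 *m U1) (F *m L2 *m U2).
  move: (F *m L1 *m Y *m U2) (A *m Q *m Y *m U2) (B *m Q *m T *m U2).
  move=> a b c e f g h; apply/matrixP => i j; rewrite !mxE; ring.
have [rm1 [r0 kry]] := sokrylov_colspan Hhess Hsub eqPH eqS.
exists dA, dB, rm1, r0; split.
- rewrite kry colspan_mulmx // /row_free eqmxMfull //.
  by rewrite row_full_unit unitmx_inv.
- apply: le_trans (specnormN_le (specnormM_le (specnormM_le nF nL1) nQi)) _.
  by clear -eta0; lra.
- have n1D : specnorm (1%:M + D1) <= 2.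
    apply: le_trans (specnormD_le (specnorm1 R d) nD1) _; clear -eta64; lra.
  have nLY : specnorm (L2 - L1 *m Y) <= 16.
    apply: le_trans (specnormD_le nL2 (specnormN_le (specnormM_le nL1 nY))) _.
    by clear -eta64; lra.
  apply: le_trans (specnormN_le (specnormM_le (specnormM_le (specnormD_le
    (specnormM_le nF nLY) nG) n1D) nQi)) _.
  (* As [1 <= mu], the bound is at most (513 * 16 + 256) * 2 * 4 = 67712 times [eta * mu], below
     [300 ^+ 2]. *)
  by clear -eta0 eta64 mu1; nra.
Qed.

End BackwardError.

(** * Reduction of degenerate data to the nondegenerate case *)

Section Perturbation.
Variable R : realType.
Local Notation C := R[i].

Lemma distxx n (S : {vspace 'cV[C]_n}) : dist S S = 0.
Proof. by rewrite /dist subrr specnorm0. Qed.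

Lemma small_scaling (a b c e : R) : 0 <= a -> 0 <= b -> 0 <= c -> 0 < e ->
  exists t, [/\ 0 < t <= 1, t * a <= e, t * b <= e & t * c <= e].
Proof.
move=> a0 b0 c0 e0; pose K := e + a + b + c; exists (e / (K + 1)).
have den : 0 < K + 1 by rewrite /K; lra.
have small x : 0 <= x -> x <= K -> e / (K + 1) * x <= e.
  move=> x0 xK; rewrite -mulrA ler_piMr ?(ltW e0) // mulrC ler_pdivrMr //; lra.
split; try by apply: small => //; rewrite /K; lra.
by rewrite divr_gt0 //= ler_pdivrMr // /K; lra.
Qed.

(** Only [U2], [y] and [H] are moved, by multiples of a small [t], so the span of [Q] stays the
    same. The price is an increase of [eta] by [eps]. *)
Lemma backward_error_perturbed n k d (A B : 'M[C]_n) (Q : 'M_(n, d))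
    (Qi : 'M_(d, n)) (U1 U2 : 'M_(d, k)) (y : 'cV_d) (L : 'M_(k, d + d))
    (z : 'cV_n) (H : 'M_(k + 1, k)) (eta eps mu : R) :
  Qi *m Q = 1%:M -> specnorm Q <= 2 -> specnorm Qi <= 4 ->
  L *m col_mx U1 U2 = 1%:M -> specnorm L <= 4 -> specnorm U1 <= 2 ->
  1 <= mu -> specnorm A <= mu -> specnorm B <= mu ->
  0 <= eta -> 0 < eps -> 64 * (eta + eps) <= 1 ->
  specnorm (Q *m (U1 - row_mx U2 y *m H)) <= eta ->
  specnorm (A *m Q *m U1 + B *m Q *m U2 - row_mx (Q *m U1) z *m H) <= eta ->
  (forall (i : 'I_(k + 1)) (j : 'I_k), (j.+1 < i)%N -> H i j = 0) ->
  (d <= k + 1)%N ->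
  exists dA dB rm1 r0,
    [/\ sokrylov k (A + dA) (B + dB) rm1 r0 = colspan Q,
        specnorm dA <= 300 ^+ 2 * (eta + eps)
      & specnorm dB <= 300 ^+ 2 * (eta + eps) * mu].
Proof.
move=> QiQ nQ nQi LU nL nU1 mu1 nA nB eta0 eps0 eta64 nE nR Hhess dk.
pose W := row_mx U2 y; pose P0 := row_mx (Q *m U1) z.
have [N Nfree] := row_free_perturbation W dk.
(* [D] is 1 exactly at the zero subdiagonal entries of [H], so [H + tc *: D] stays Hessenberg and
   has none left. *)
pose D : 'M[C]_(k + 1, k) :=
  \matrix_(i, j) ((i == j.+1 :> nat) && (H i j == 0))%:R.
pose N1 := lsubmx N.
(* [M1] and [M2] are the coefficients of [t] and of its square in the second block residual, and
   [M3] that of [t] in the first. [M4] is the defect of [L] as a left inverse of the moved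
   columns. *)
pose M1 := Q *m - (W *m D + N *m H); pose M2 := Q *m - (N *m D).
pose M3 := B *m Q *m N1 - P0 *m D.
pose M4 := L *m col_mx 0 N1.
(* The bound [eps] serves the residuals, and 1/2 makes [1%:M + tc *: M4] invertible with inverse of
   norm at most 2, whence 2 * 4 = 8 for the new left inverse. *)
have m0 : 0 < Num.min eps 2^-1 by rewrite lt_min eps0 invr_gt0 ltr0n.
have [t [/andP[t0 t1]]] := small_scaling
  (addr_ge0 (specnorm_ge0 M1) (specnorm_ge0 M2)) (specnorm_ge0 M3)
  (specnorm_ge0 M4) m0.
rewrite !le_min => /andP[t12 _] /andP[t3 _] /andP[_ t4].
have [tc [tc0 tcM]] : exists tc : C, tc != 0 /\
    forall m p (M : 'M[C]_(m, p)), specnorm (tc *: M) <= t * specnorm M.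
  exists (real_complex R t); split=> [|m p M]; last exact/specnorm_scale/ltW.
  by rewrite fmorph_eq0 gt_eqF.
have Wt : W + tc *: N = row_mx (U2 + tc *: N1) (y + tc *: rsubmx N).
  by rewrite -add_row_mx -scale_row_mx hsubmxK.
have M4h : specnorm (tc *: M4) <= 2^-1.
  by apply: le_trans (tcM _ _ _) t4.
have [Gunit nG] := unitmx_near1 M4h.
apply: (@backward_error R n k d A B Q Qi U1 (U2 + tc *: N1) (y + tc *: rsubmx N)
  (invmx (1%:M + tc *: M4) *m L) z (H + tc *: D)) => //.
- rewrite -mulmxA.
  have -> : col_mx U1 (U2 + tc *: N1) = col_mx U1 U2 + tc *: col_mx 0 N1.
    by rewrite scale_col_mx add_col_mx scaler0 addr0.
  by rewrite mulmxDr LU -scalemxAr mulVmx.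
- by apply: le_trans (specnormM_le nG nL) _; clear; lra.
- by apply: le_trans nU1 _; clear; lra.
- by clear -eta0 eps0; lra.
- rewrite -Wt.
  have -> : Q *m (U1 - (W + tc *: N) *m (H + tc *: D)) =
      Q *m (U1 - W *m H) + tc *: M1 + tc *: (tc *: M2).
    rewrite /M1 /M2 !scalemxAr -!mulmxDr; congr (_ *m _).
    rewrite mulmxDl !mulmxDr -!scalemxAl -!scalemxAr.
    move: (W *m H) (W *m D) (N *m H) (N *m D) => WH WD NH ND.
    by apply/matrixP => i j; rewrite !mxE; ring.
  apply: le_trans (specnormD_le (specnormD_le nE (tcM _ _ _)) (tcM _ _ _)) _.
  (* Because [t <= 1], the quadratic term is dominated by [t * specnorm M2]. *)
  rewrite -addrA lerD2l -mulrDr; apply: le_trans t12.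
  rewrite (ler_pM2l t0) lerD2l; apply: le_trans (tcM _ _ _) _.
  exact: ler_piMl (specnorm_ge0 _) t1.
- have -> : A *m Q *m U1 + B *m Q *m (U2 + tc *: N1) -
      row_mx (Q *m U1) z *m (H + tc *: D) =
      A *m Q *m U1 + B *m Q *m U2 - P0 *m H + tc *: M3.
    rewrite /M3 scalerBr !mulmxDr -!scalemxAr -/P0.
    move: (A *m Q *m U1) (B *m Q *m U2) (B *m Q *m N1) => a b e.
    move: (P0 *m H) (P0 *m D) => f g.
    by apply/matrixP => i j; rewrite !mxE; ring.
  by apply: le_trans (specnormD_le nR (tcM _ _ _)) _; rewrite lerD2l; exact: t3.
- move=> i j ij; rewrite !mxE Hhess //.
  by rewrite gtn_eqF //= mulr0 addr0.
- move=> i j ij; rewrite !mxE ij eqxx /=.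
  have [->|Hij] := eqVneq (H i j) 0; first by rewrite add0r mulr1.
  by rewrite mulr0 addr0.
- by rewrite -Wt Nfree.
Qed.

End Perturbation.

(** * From the computed TOAR quantities to the two block equations, with explicit constants *)

Theorem corollary3p3 (R : realType) (c : R) :
  exists c' eps0 : R, 0 < eps0 /\
  forall (n k d : nat) (A B : 'M[R[i]]_n)
    (Qk : 'M[R[i]]_(n, d)) (Qk1 : 'M[R[i]]_(n, d + 1))
    (Uk : 'M[R[i]]_(d + d, k)) (Uk1 : 'M[R[i]]_((d + 1) + (d + 1), k + 1))
    (Hk : 'M[R[i]]_(k + 1, k)) (eps : R),
  (0 < k)%N ->
  0 < eps ->
  eps * max1norm A B <= eps0 ->
  toar_computed c eps A B Qk Qk1 Uk Uk1 Hk ->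
  \rank Qk = d ->
  exists (dA dB : 'M[R[i]]_n) (rm1 r0 : 'cV[R[i]]_n),
    [/\ \dim (sokrylov k (A + dA) (B + dB) rm1 r0) = d,
        dist (colspan Qk) (sokrylov k (A + dA) (B + dB) rm1 r0)
          <= c' * eps * max1norm A B,
        specnorm dA <= c' * eps * max1norm A B
      & specnorm dB <= c' * eps * max1norm A B ^+ 2].
Proof.
(* The residual contributes the first term, with 3 from [specnorm (companion A B) <= 3 * mu], and
   the perturbation contributes 1. The threshold [(64 * g)^-1] makes precise the restriction to
   first order in [eps]. *)
pose g : R := 3 * `|c| + 1.
have g1 : 1 <= g by rewrite /g lerDr mulr_ge0.
exists (300 ^+ 2 * g), (64 * g)^-1; split.
  by rewrite invr_gt0 mulr_gt0 // (lt_le_trans ltr01).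
move=> n k d A B Q Q1 U V H eps _ eps0 epsmu.
case=> [dk [q ->] [U1 [U2 [x [y [b [-> ->]]]]]]].
move=> Hhess oQ _ oU _ res _.
set mu := max1norm A B in epsmu *.
have mu1 : 1 <= mu by rewrite le_max lexx.
have nA : specnorm A <= mu by rewrite !le_max lexx !orbT.
have nB : specnorm B <= mu by rewrite !le_max lexx !orbT.
have epsmu64 : 64 * (g * (eps * mu)) <= 1.
  by rewrite mulrA mulrC -ler_pdivlMr ?div1r // mulr_gt0 // (lt_le_trans ltr01).
have c0 := normr_ge0 c; have cc := ler_norm c.
have epsle : eps <= eps * mu by rewrite ler_peMr // ltW.
have ceps : c * eps <= 2^-1.
  apply: (@le_trans _ _ (`|c| * (eps * mu))).
    by apply: le_trans (ler_wpM2l c0 epsle); rewrite ler_wpM2r // ltW.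
  have : 0 <= eps * mu by rewrite (le_trans (ltW eps0)).
  move: epsmu64; rewrite /g; move: (eps * mu) (`|c|) c0; clear => e f; nra.
have [nQ [Qi [QiQ nQi]]] := near_orthonormal_inverse (le_trans oQ ceps).
have [nU [L [LU nL]]] := near_orthonormal_inverse (le_trans oU ceps).
have nU1 : specnorm U1 <= 2.
  by apply: le_trans nU; rewrite -[U1 in leLHS](col_mxKu U1 U2) specnorm_usubmx.
have {}res : specnorm (companion A B *m kronI2 Q *m col_mx U1 U2 -
    kronI2 (row_mx Q q) *m col_mx (block_mx U1 x 0 b%:M) (block_mx U2 y 0 0) *m H)
    <= 3 * `|c| * (eps * mu).
  apply: le_trans res _.
  have nC := specnorm_companion A B.
  apply: (@le_trans _ _ (`|c| * (eps * (3 * mu)))); last by clear; lra.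
  rewrite -mulrA; apply: (@le_trans _ _ (`|c| * (eps * specnorm (companion A B)))).
    by rewrite ler_wpM2r // mulr_ge0 ?specnorm_ge0 // ltW.
  rewrite ler_wpM2l // ler_pM2l //; apply: le_trans nC _.
  by clear -nA nB mu1; lra.
(* The last row of the lower half of the computed basis is zero, so [q] enters only the first block
   row, through the column [z = Q *m x + q *m b%:M]. The second block residual therefore lies in the
   span of [Q]. *)
have resE : companion A B *m kronI2 Q *m col_mx U1 U2 -
    kronI2 (row_mx Q q) *m col_mx (block_mx U1 x 0 b%:M) (block_mx U2 y 0 0) *m H =
    col_mx (A *m Q *m U1 + B *m Q *m U2 - row_mx (Q *m U1) (Q *m x + q *m b%:M) *m H)
           (Q *m (U1 - row_mx U2 y *m H)).
  rewrite /companion /kronI2 mulmx_block mul_block_col !mul1mx !mul0mx !mulmx0.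
  rewrite !(addr0, add0r) mul_block_col !mul0mx addr0 add0r.
  rewrite !mul_row_block !mulmx0 !addr0 mul_col_mx opp_col_mx add_col_mx.
  by rewrite -mul_mx_row mulmxBr mulmxA.
rewrite resE in res.
have resU := le_trans (specnorm_usubmx _) res; rewrite col_mxKu in resU.
have resD := le_trans (specnorm_dsubmx _) res; rewrite col_mxKd in resD.
have epsmu0 : 0 < eps * mu := lt_le_trans eps0 epsle.
have eta0 := mulr_ge0 (mulr_ge0 (ler0n R 3) c0) (ltW epsmu0).
have small : 64 * (3 * `|c| * (eps * mu) + eps * mu) <= 1.
  by move: epsmu64; rewrite /g (mulrDl (3 * `|c|) 1) mul1r.
rewrite -addn1 in dk.
have [dA [dB [rm1 [r0 [kry ndA ndB]]]]] := backward_error_perturbed QiQ nQ nQi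
  LU nL nU1 mu1 nA nB eta0 epsmu0 small resD resU Hhess dk.
have gE : 300 ^+ 2 * (3 * `|c| * (eps * mu) + eps * mu) = 300 ^+ 2 * g * eps * mu.
  by rewrite /g; clear; ring.
rewrite gE in ndA ndB.
exists dA, dB, rm1, r0; split; last 2 first.
- exact: ndA.
- by rewrite expr2 mulrA; exact: ndB.
- by rewrite kry (dim_colspan QiQ).
(* The Krylov subspace equals the span of [Q], so only the nonnegativity of the bound remains. *)
- rewrite kry distxx !mulr_ge0 ?exprn_ge0 ?ltW //.
    exact: lt_le_trans g1.
  exact: lt_le_trans mu1.
Qed.
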